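(* Let $t\ge2$, $n\ge2t$ and $q=2^m$ with $m\ge1$. For $x=(x_1,\dots,x_n)\in\mathbb F_q^n$ and $1\le j\le t$ put $$C_j(x)=\sum_{\substack{1\le i\le n\\ i\equiv n+j \ (\mathrm{mod}\ t)}}x_i,\qquad W_{n,t}(x)=(x_1,\dots,x_n,C_1(x),\ldots,C_t(x))\in\mathbb F_q^{n+t},$$ where sums are in $\mathbb F_q$ (i.e. bitwise XOR). If $H:\mathbb F_q^n\to\mathbb F_q$ is an arbitrary function such that the family $\{(W_{n,t}(x),H(x)):x\in\mathbb F_q^n\}\subseteq\mathbb F_q^{n+t+1}$ corrects one exact adjacent burst of deletions of length $t$, then $$q\ge n+\left\lfloor\frac nt\right\rfloor+2.$$
   Context: For a word $z=z_1\cdots z_L$ and $1\le d\le L-t+1$, put $\mathsf B_{t,d}(z)=z_1\cdots z_{d-1}z_{d+t}\cdots z_L$. A family of words of length $L$ corrects one exact adjacent burst of length $t$ if for distinct words $z,z'$ of the family the sets $\{\mathsf B_{t,d}(z):1\le d\le L-t+1\}$ and $\{\mathsf B_{t,d}(z'):1\le d\le L-t+1\}$ are disjoint. *)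

(* Defs.v *)
From HB Require Import structures.
From mathcomp Require Import all_boot all_order all_algebra.

Set Implicit Arguments.
Unset Strict Implicit.
Unset Printing Implicit Defensive.

Import GRing.Theory.

(* Positions are 1-based: burst_del t d z removes z_d, ..., z_{d+t-1}, and is
   only meant for 1 <= d <= size z - t + 1. *)
Definition burst_del (T : Type) (t d : nat) (z : seq T) : seq T :=
  take d.-1 z ++ drop (d.-1 + t) z.

(* The list has (size z).+1 - t entries, hence none when size z < t. *)
Definition burst_ball (T : Type) (t : nat) (z : seq T) : seq (seq T) :=
  [seq burst_del t d z | d <- iota 1 ((size z).+1 - t)].

Definition corrects_burst (T : finType) (t L : nat) (S : {set L.-tuple T}) :
    Prop :=
  forall z z' : L.-tuple T, z \in S -> z' \in S -> z <> z' ->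
  forall y : seq T, ~ (y \in burst_ball t z /\ y \in burst_ball t z').

(* The ordinal i : 'I_n stands for the coordinate of 1-based index i.+1. *)
Definition class_sum (F : finFieldType) (n t j : nat) (x : n.-tuple F) : F :=
  (\sum_(i < n | i.+1 == n + j %[mod t]) tnth x i)%R.

Definition W (F : finFieldType) (n t : nat) (x : n.-tuple F) :
    (n + t).-tuple F :=
  [tuple of x ++ [tuple class_sum t j.+1 x | j < t]].

Definition W_family (F : finFieldType) (n t : nat) (H : n.-tuple F -> F) :
    {set (n + t + 1).-tuple F} :=
  [set [tuple of W t x ++ [tuple H x]] | x : n.-tuple F].

(* Main.v *)
(* The words W(x) are exactly the words of length n + t each of whose residue
   classes modulo t ("rows") sums to zero.  Given u of length n with row sums
   sigma, inserting the matching sigma's at any of the n + 1 places gives such a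
   word w_d; if every u_i differs from the sigma of its row, the w_d are
   distinct, and they share u after a deletion, so the symbols H(w_d) are
   distinct.  Moreover, deleting the last t symbols of (W(x'), H(x')) leaves
   (x', C_1(x')); comparing with a burst that removes the symbol s of the row of
   C_1 from W(x) and leaves x' <> x shows H(x) <> s.  If that row of u has
   distinct entries, each H(w_d) avoids these n/t + 1 further symbols, whence
   the bound.  Such a u is found greedily once the field is not too small, which
   a cruder choice of u (mostly ones, all row sums zero) already guarantees. *)

Require Import Defs.
From mathcomp Require Import all_boot all_order all_algebra.
From mathcomp Require Import all_field zify.

Set Implicit Arguments.
Unset Strict Implicit.
Unset Printing Implicit Defensive.

Import GRing.Theory.

(* Positions are 0-based from here on, so C_1 sits at position n. *)
Definition rowsum (F : nmodType) (t N r : nat) (u : nat -> F) : F :=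
  (\sum_(0 <= i < N | i == r %[mod t]) u i)%R.

Definition del (T : Type) (t d : nat) (w : nat -> T) (i : nat) : T :=
  w (if i < d then i else i + t).

(** The word w_d. In characteristic 2 the sum of a row, inserted without a sign, brings that row to
    zero. *)
Definition ins (F : nmodType) (n t d : nat) (u : nat -> F) (i : nat) : F :=
  if i < d then u i else if i < d + t then rowsum t n i u else u (i - t).

Definition word (T : Type) (n : nat) (w : nat -> T) : n.-tuple T :=
  [tuple w i | i < n].

(** * Row sums and their behaviour under deletion *)

Lemma eq_rowsum (F : nmodType) t N r (u v : nat -> F) :
  (forall i, i < N -> u i = v i) -> rowsum t N r u = rowsum t N r v.
Proof.
move=> E; rewrite /rowsum big_nat_cond [RHS]big_nat_cond.
by apply: eq_bigr => i /andP[/andP[_ /E]].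
Qed.

Lemma rowsum_mod (F : nmodType) t N r r' (u : nat -> F) :
  r = r' %[mod t] -> rowsum t N r u = rowsum t N r' u.
Proof. by rewrite /rowsum => ->. Qed.

(** The next index in the row of [l] is [l + t], outside the range. *)
Lemma rowsum_last (F : nmodType) t N l (u : nat -> F) :
  l < N -> N <= l + t -> rowsum t N l u = (rowsum t l l u + u l)%R.
Proof.
move=> lN Nl; rewrite /rowsum (big_cat_nat _ (n := l)) //=; last exact: ltnW.
congr (_ + _)%R; rewrite big_ltn_cond // eqxx big_nat_cond big_pred0 ?addr0 //.
move=> i; apply/negP => /andP[/andP[li iN]] /eqP E.
have : t %| i - l by rewrite -eqn_mod_dvd ?E //; lia.
by move/dvdn_leq; lia.
Qed.

(** The deleted window meets the row of [p] in [p] only, and indices beyond it keep their residue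
    when shifted by [t]. *)
Lemma rowsum_del (F : nmodType) t n d p (w : nat -> F) :
  d <= n -> d <= p < d + t ->
  rowsum t (n + t) p w = (rowsum t n p (del t d w) + w p)%R.
Proof.
move=> dn /andP[dp pdt]; rewrite /rowsum.
rewrite (big_cat_nat _ (n := d + t)) ?leq_add2r //=.
rewrite -[X in (X + _)%R]/(rowsum t (d + t) p w) rowsum_last //; last lia.
rewrite [in RHS](big_cat_nat _ (n := d)) //= -addrA [(w p + _)%R]addrC addrA.
congr (_ + _ + _)%R.
  rewrite /rowsum (big_cat_nat _ (n := d)) //= [X in (_ + X)%R]big_nat_cond.
  rewrite [X in (_ + X)%R]big_pred0 ?addr0.
    rewrite big_nat_cond [RHS]big_nat_cond.
    by apply: eq_bigr => i /andP[/andP[_ id] _]; rewrite /del id.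
  move=> i; apply/negP => /andP[/andP[di ip]] /eqP E.
  have : t %| p - i by rewrite -eqn_mod_dvd ?E //; lia.
  by move/dvdn_leq; lia.
rewrite big_addn addnK big_nat_cond [RHS]big_nat_cond.
by apply: eq_big => [i|i /andP[/andP[di _] _]]; rewrite ?modnDr // /del ltnNge di.
Qed.

(** * The words W(x) and their burst balls *)

Lemma val_word (T : Type) n (w : nat -> T) : val (word n w) = mkseq w n.
Proof. by rewrite /= /mkseq -val_enum_ord -map_comp. Qed.

Lemma class_sum_word (F : finFieldType) n t j (w : nat -> F) :
  class_sum t j.+1 (word n w) = rowsum t n (n + j) w.
Proof.
rewrite /class_sum /rowsum big_mkord; apply: eq_big => i.
  by rewrite addnS -addn1 -[(n + j).+1]addn1 eqn_modDr.
by move=> _; rewrite tnth_mktuple.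
Qed.

Definition zero_rows (F : nmodType) (t N : nat) (w : nat -> F) : Prop :=
  forall r, rowsum t N r w = 0%R.

Lemma del_id (T : Type) t n (w : nat -> T) i : i < n -> del t n w i = w i.
Proof. by rewrite /del => ->. Qed.

Lemma W_wordE (F : finFieldType) n t (w : nat -> F) :
  W t (word n w) = mkseq w n ++ mkseq (fun j => rowsum t n (n + j) w) t :> seq F.
Proof.
rewrite -val_word /= /mkseq -[iota 0 t]val_enum_ord -map_comp; congr (_ ++ _).
by apply: eq_map => j; rewrite class_sum_word.
Qed.

(** This prefix is what survives of the tagged word when its last [t] symbols are deleted. *)
Lemma W_take (F : finFieldType) n t (w : nat -> F) : 0 < t ->
  take n.+1 (W t (word n w)) = rcons (mkseq w n) (rowsum t n n w).
Proof.
case: t => // t _; rewrite -cats1 W_wordE take_cat size_mkseq ltnNge leqnSn /=.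
by rewrite subSnn /= take0 addn0.
Qed.

(** The last [t] positions meet each row once, so zero row sums force the check symbols there. *)
Lemma W_zero_rows (F : finFieldType) n t (w : nat -> F) :
  2 \in [pchar F]%R -> zero_rows t (n + t) w ->
  W t (word n w) = mkseq w (n + t) :> seq F.
Proof.
move=> ch2 w0; rewrite W_wordE /mkseq iotaD map_cat; congr (_ ++ _).
rewrite add0n -[n in RHS]addn0 iotaDl -map_comp.
apply/eq_in_map => j; rewrite mem_iota add0n => /andP[_ jt] /=.
have := w0 (n + j); rewrite (@rowsum_del _ _ _ n) ?leq_addr ?ltn_add2l //=.
rewrite (eq_rowsum _ _ (@del_id _ t n w)) => /eqP.
by rewrite addr_eq0 oppr_pchar2 // => /eqP.
Qed.

Lemma burst_mkseq (T : Type) n t d (w : nat -> T) : d <= n ->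
  take d (mkseq w (n + t)) ++ drop (d + t) (mkseq w (n + t)) =
  mkseq (del t d w) n.
Proof.
move=> dn; rewrite /mkseq -map_take -map_drop take_iota drop_iota.
rewrite -[n in RHS](subnKC dn) iotaD map_cat (minn_idPl _) ?(leq_trans dn) ?leq_addr //.
congr (_ ++ _).
  by apply/eq_in_map => i; rewrite mem_iota /del => /andP[_ ->].
rewrite !add0n addnC iotaDl -map_comp (_ : _ - _ = n - d); last lia.
apply/eq_in_map => i; rewrite mem_iota => /andP[di _] /=.
by rewrite /del ltnNge di addnC.
Qed.

Lemma mem_burst_ball (T : eqType) t d (z : seq T) :
  d + t <= size z -> take d z ++ drop (d + t) z \in burst_ball t z.
Proof.
move=> dz; apply/mapP; exists d.+1 => //.
by rewrite mem_iota; lia.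
Qed.

Definition tagged_word (F : finFieldType) n t (H : n.-tuple F -> F) (w : nat -> F) :
  (n + t + 1).-tuple F := [tuple of W t (word n w) ++ [tuple H (word n w)]].

Lemma take_tagged_word (F : finFieldType) n t (H : n.-tuple F -> F) (w : nat -> F) :
  take n (tagged_word t H w) = mkseq w n.
Proof. by rewrite /= W_wordE -catA take_size_cat ?size_mkseq. Qed.

Lemma corrects_word (F : finFieldType) n t (H : n.-tuple F -> F) (v w : nat -> F) y :
  corrects_burst t (W_family t H) ->
  y \in burst_ball t (tagged_word t H v) ->
  y \in burst_ball t (tagged_word t H w) ->
  forall i, i < n -> v i = w i.
Proof.
move=> hc yv yw i ltin.
have E : tagged_word t H v = tagged_word t H w.
  apply/eqP/negPn/negP => /eqP vw; apply: (hc _ _ _ _ vw y) => //.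
  - exact: imset_f.
  - exact: imset_f.
rewrite -(nth_mkseq 0%R v ltin) -(take_tagged_word t H) E take_tagged_word.
by rewrite nth_mkseq.
Qed.

Lemma mem_ball_del (F : finFieldType) n t d (H : n.-tuple F -> F) (w : nat -> F) :
  2 \in [pchar F]%R -> zero_rows t (n + t) w -> d <= n ->
  rcons (mkseq (del t d w) n) (H (word n w)) \in
    burst_ball t (tagged_word t H w).
Proof.
move=> ch2 w0 dn; rewrite -burst_mkseq // -cats1 -catA.
have -> : val (tagged_word t H w) = mkseq w (n + t) ++ [:: H (word n w)].
  by rewrite -(W_zero_rows ch2 w0).
have sz : size (mkseq w (n + t)) = n + t by rewrite size_mkseq.
set s := mkseq w _ in sz *; set h := H _.
have -> : drop (d + t) s ++ [:: h] = drop (d + t) (s ++ [:: h]).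
  rewrite drop_cat sz; case: ltngtP => // [ndt|->]; first lia.
  by rewrite subnn drop0 -sz drop_size.
rewrite -(takel_cat [:: h]) ?sz; last lia.
by apply: mem_burst_ball; rewrite size_cat sz /=; lia.
Qed.

Lemma mem_ball_check (F : finFieldType) n t (H : n.-tuple F -> F) (w : nat -> F) :
  0 < t -> rcons (mkseq w n) (rowsum t n n w) \in
    burst_ball t (tagged_word t H w).
Proof.
move=> t0; rewrite -W_take //.
have := @mem_burst_ball _ t n.+1 (tagged_word t H w).
rewrite size_tuple drop_oversize ?size_tuple; last lia.
rewrite cats0 (_ : take _ _ = take n.+1 (W t (word n w))); first by apply; lia.
by apply: takel_cat; rewrite size_tuple; lia.
Qed.

(** * Inserted row sums and the values of [H] *)

Lemma modn_window t d r : 0 < t -> exists2 p, d <= p < d + t & p = r %[mod t].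
Proof.
move=> t0; pose p := d %/ t * t + r %% t.
have pr : p = r %[mod t] by rewrite /p modnMDl modn_mod.
have := ltn_pmod d t0; have := ltn_pmod r t0; have := divn_eq d t => dE rt dt.
case: (leqP d p) => dp; [exists p | exists (p + t)] => //; rewrite ?modnDr //.
  by rewrite dp /p; lia.
by rewrite /p; lia.
Qed.

Lemma del_ins (F : nmodType) n t d (u : nat -> F) i :
  del t d (ins n t d u) i = u i.
Proof.
rewrite /del /ins; case: (ltnP i d) => [-> //|di].
by rewrite ltn_add2r ltnNge (leq_trans di) ?leq_addr //= ltnNge di addnK.
Qed.

Lemma ins_zero_rows (F : finFieldType) n t d (u : nat -> F) :
  2 \in [pchar F]%R -> 0 < t -> d <= n -> zero_rows t (n + t) (ins n t d u).
Proof.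
move=> ch2 t0 dn r; have [p pd rp] := modn_window d r t0.
rewrite -(rowsum_mod _ _ rp) (rowsum_del _ dn pd).
rewrite (eq_rowsum _ _ (fun i _ => del_ins n t d u i)).
case/andP: pd => dp pt; rewrite /ins ltnNge dp pt /=.
exact: addrr_pchar2.
Qed.

(** With equal tags both words shrink to [u] followed by that tag, so they would coincide; yet at
    position [d] one holds the row sum and the other still holds [u d]. *)
Lemma ins_collision (F : finFieldType) n t (H : n.-tuple F -> F) u d e :
  2 \in [pchar F]%R -> 0 < t -> corrects_burst t (W_family t H) ->
  d < e <= n -> u d != rowsum t n d u ->
  H (word n (ins n t d u)) != H (word n (ins n t e u)).
Proof.
move=> ch2 t0 hc /andP[de en] ud; apply: contraNneq ud => E.
have dn := leq_trans (ltnW de) en.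
have yd := mem_ball_del H ch2 (ins_zero_rows u ch2 t0 dn) dn.
have ye := mem_ball_del H ch2 (ins_zero_rows u ch2 t0 en) en.
rewrite E (eq_mkseq (del_ins n t d u)) in yd.
rewrite (eq_mkseq (del_ins n t e u)) in ye.
have := corrects_word hc yd ye (leq_trans de en).
by rewrite /ins ltnn de -[X in X < _]addn0 ltn_add2l t0 => ->.
Qed.

(** If the tag were [w p], it would be the first check symbol of [del t d w], because the row of [p]
    in [w] sums to zero. The balls of [w] and [del t d w] would then meet, although these words
    differ at [d]. *)
Lemma check_avoid (F : finFieldType) n t (H : n.-tuple F -> F) w d p :
  2 \in [pchar F]%R -> corrects_burst t (W_family t H) ->
  zero_rows t (n + t) w -> d < n -> d <= p < d + t -> p = n %[mod t] ->
  w d != w (d + t) -> H (word n w) != w p.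
Proof.
move=> ch2 hc w0 dn dp pn wd; apply: contraNneq wd => E.
have yw := mem_ball_del H ch2 w0 (ltnW dn).
have t0 : 0 < t by lia.
have := mem_ball_check H (del t d w) t0.
have -> : rowsum t n n (del t d w) = w p.
  have := w0 p; rewrite (rowsum_del _ (ltnW dn) dp) (rowsum_mod _ _ pn) => /eqP.
  by rewrite addr_eq0 oppr_pchar2 // => /eqP.
rewrite -E => yd; have := corrects_word hc yd yw dn.
by rewrite /del ltnn => ->.
Qed.

(** The offset [a] serves words whose first entries may equal their row sums. The condition on [u]
    stops before [n] because a collision tests [u] at the smaller of two insertion points. *)
Lemma ins_counting (F : finFieldType) n t (H : n.-tuple F -> F) u a (V : seq F) :
  2 \in [pchar F]%R -> 0 < t -> corrects_burst t (W_family t H) ->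
  (forall d, a <= d < n -> u d != rowsum t n d u) ->
  uniq V ->
  (forall d, a <= d <= n -> H (word n (ins n t d u)) \notin V) ->
  n.+1 - a + size V <= #|F|.
Proof.
move=> ch2 t0 hc ud uV hV; pose h d := H (word n (ins n t d u)).
have uD : uniq ([seq h d | d <- iota a (n.+1 - a)] ++ V).
  rewrite cat_uniq uV andbT; apply/andP; split; last first.
    apply/hasPn => v vV; apply/negP => /mapP[d]; rewrite mem_iota => ad E.
    have /hV : a <= d <= n by lia.
    by rewrite -/(h d) -E vV.
  rewrite map_inj_in_uniq ?iota_uniq // => d e; rewrite !mem_iota => ad ae E.
  have inj i j : a <= i < j -> j <= n -> h i = h j -> False.
    move=> /andP[ai ij] jn; apply/eqP; apply: ins_collision => //.
      by rewrite ij.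
    by apply: ud; rewrite ai (leq_trans ij).
  case: (ltngtP d e) => // de; [case: (inj d e)|case: (inj e d)] => //; lia.
have := max_card (mem ([seq h d | d <- iota a (n.+1 - a)] ++ V)).
by rewrite (card_uniqP uD) size_cat size_map size_iota.
Qed.

(** * A first, cruder bound on the field size *)

Lemma eqmod_le t n p : p = n %[mod t] -> p < n + t -> p <= n.
Proof.
move=> /eqP pn pt; rewrite leqNgt; apply/negP => np.
have : t %| p - n by rewrite -eqn_mod_dvd // ltnW.
by move/dvdn_leq; lia.
Qed.

Lemma ins_window (F : nmodType) n t d p (u : nat -> F) :
  d <= p < d + t -> ins n t d u p = rowsum t n p u.
Proof. by case/andP=> dp pdt; rewrite /ins ltnNge dp pdt. Qed.

(** Either [p] and [p + t] lie on the same side of the inserted window and hold entries of [u], or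
    exactly one of them lies in the window and holds the row sum. *)
Lemma ins_neq (F : nmodType) n t d p (u : nat -> F) : 0 < t ->
  u p != rowsum t n p u ->
  (p + t < d -> u p != u (p + t)) -> (d + t <= p -> u (p - t) != u p) ->
  ins n t d u p != ins n t d u (p + t).
Proof.
move=> t0 up ul ur; have pp : rowsum t n (p + t) u = rowsum t n p u.
  by apply: rowsum_mod; rewrite modnDr.
case: (ltnP p d) => pd.
  case: (ltnP (p + t) d) => ptd; first by rewrite /ins pd ptd ul.
  rewrite [X in _ != X]ins_window ?pp; last lia.
  by rewrite /ins pd.
have -> : ins n t d u (p + t) = u p.
  by rewrite /ins ltn_add2r !ltnNge pd (leq_trans pd) ?leq_addr //= addnK.
case: (ltnP p (d + t)) => pdt; first by rewrite ins_window ?pd // eq_sym.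
by rewrite /ins !ltnNge pd pdt /= ur.
Qed.

Lemma field_lower_bound (F : finFieldType) n t (H : n.-tuple F -> F) :
  2 \in [pchar F]%R -> 1 < t -> 2 * t <= n -> corrects_burst t (W_family t H) ->
  n - t + 2 <= #|F|.
Proof.
move=> ch2 t1 tn hc.
(* The first [t] entries balance the [n - t] ones that follow, so all row sums vanish. *)
pose u i : F := if i < t then rowsum t (n - t) i (fun=> 1%R) else 1%R.
have t0 := ltnW t1.
have u0 r : rowsum t n r u = 0%R.
  have [p pt pr] := modn_window 0 r t0.
  rewrite -(rowsum_mod _ _ pr) -[n in rowsum t n](@subnK t); last lia.
  rewrite (@rowsum_del _ _ _ 0) //.
  rewrite (@eq_rowsum _ _ _ _ (del t 0 u) (fun=> 1%R)); last first.
    by move=> i _; rewrite /del /u /= ltnNge leq_addl.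
  by rewrite /u (_ : p < t) // addrr_pchar2.
have u1 d : t <= d -> u d = 1%R by rewrite /u ltnNge => ->.
rewrite (_ : n - t + 2 = n.+1 - t + size [:: 0%R : F]); last by rewrite /=; lia.
apply: (ins_counting (u := u) ch2 t0 hc) => // d /andP[td dn].
  by rewrite u1 // u0 oner_eq0.
(* [check_avoid] wants a start below [n]. For [d = n] the burst at [n.-1] still covers position [n],
   as [t > 1]. *)
rewrite inE; pose e := if d < n then d else n.-1.
have en : e < n by rewrite /e; case: ifP => //; lia.
have te : t <= e by rewrite /e; case: ifP; lia.
have [p pd pn] := modn_window d n t0.
have pw : ins n t d u p = 0%R by rewrite ins_window.
have pe : e <= p < e + t.
  rewrite /e; case: ifP => // dn'; have {}dn' : d = n by lia.
  by have := eqmod_le pn; lia.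
rewrite -pw; apply: (check_avoid ch2 hc _ en pe pn).
  exact: ins_zero_rows.
apply: ins_neq => //; first by rewrite u0 u1 ?oner_eq0.
  by move=> etd; exfalso; move: etd; rewrite /e; case: ifP; lia.
by move=> etd; exfalso; move: etd; rewrite /e; case: ifP; lia.
Qed.

(** * Greedy choice of a word with spread rows *)

Lemma greedy (A : finType) (forb : (nat -> A) -> nat -> seq A) (a : A) n :
  (forall f g i, (forall j, j < i -> f j = g j) -> forb f i = forb g i) ->
  (forall f i, i < n -> size (forb f i) < #|A|) ->
  exists u, forall i, i < n -> u i \notin forb u i.
Proof.
move=> ext; elim: n => [|n IH] sz; first by exists (fun=> a).
have [|u hu] := IH; first by move=> f i /ltnW; apply: sz.
have [b hb] : exists b, b \notin forb u n.
  apply/existsP; rewrite -negb_forall; apply/negP => /forallP all.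
  have := sz u n (ltnSn n); rewrite ltnNge => /negP; apply.
  apply: leq_trans (card_size _); apply/subset_leq_card/subsetP => x _; exact: all.
pose v i := if i < n then u i else b.
have vu i : i <= n -> forb v i = forb u i.
  by move=> ltin; apply: ext => j ji; rewrite /v (leq_trans ji).
exists v => i; rewrite ltnS => ltin; rewrite vu // /v.
by move: ltin; rewrite leq_eqVlt => /orP[/eqP->|ltin]; rewrite ?ltnn // ltin hu.
Qed.

(** Stepping back from [i] yields exactly [i %/ t] entries, and the subtraction never truncates. *)
Definition row_prefix (T : Type) (t : nat) (u : nat -> T) (i : nat) : seq T :=
  [seq u (i - t * b.+1) | b <- iota 0 (i %/ t)].

Lemma row_prefixP (T : eqType) t (u : nat -> T) i v : 0 < t ->
  reflect (exists j, [/\ j < i, j = i %[mod t] & v = u j]) (v \in row_prefix t u i).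
Proof.
move=> t0; apply: (iffP mapP) => [[b]|[j [ji /esym/eqP jt ->]]].
  rewrite mem_iota => /andP[_ bi] ->; exists (i - t * b.+1).
  have bt : t * b.+1 <= i.
    by rewrite mulnC; apply: leq_trans (leq_divM i t); rewrite leq_mul2r bi orbT.
  split => //; first by nia.
  by apply/esym/eqP; rewrite eqn_mod_dvd ?leq_subr // subKn // dvdn_mulr.
have : t %| i - j by rewrite -eqn_mod_dvd // ltnW.
case/dvdnP => [[|k] kE]; first by lia.
exists k; last by congr u; lia.
by rewrite mem_iota /= add0n leq_divRL //; lia.
Qed.

Lemma exists_spread (F : finFieldType) n t :
  2 \in [pchar F]%R -> 1 < t -> 2 * t <= n -> n - t + 2 <= #|F| ->
  exists u : nat -> F,
    (forall i, i < n -> u i != rowsum t n i u) /\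
    (forall i j, i < j < n -> i = j %[mod t] -> u i != u j).
Proof.
move=> ch2 t1 tn q; have t0 := ltnW t1.
(* Away from the last block, avoiding the running row sum keeps it nonzero
   after each step; on the last block, the second list keeps the final row sum
   off the earlier entries of the row. *)
pose forb (f : nat -> F) i := row_prefix t f i ++
  if i + t < n then [:: rowsum t i i f]
  else [seq (rowsum t i i f + x)%R | x <- row_prefix t f i].
have [|f i|u hu] := @greedy F forb 0%R n.
- move=> f g i fg; rewrite /forb /row_prefix (eq_rowsum _ _ fg).
  rewrite (_ : [seq f _ | b <- _] = [seq g (i - t * b.+1) | b <- iota 0 (i %/ t)]) //.
  apply/eq_in_map => b; rewrite mem_iota => /andP[_ bi]; apply: fg.
  by have := leq_divM i t; nia.
(* The lists have [i %/ t + 1] or [2 * (i %/ t)] entries, both below [n - t + 2]. *)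
- move=> ltin; apply: leq_trans q.
  have := leq_divM i t; rewrite /forb /row_prefix size_cat size_map size_iota.
  by case: ifP => itn; rewrite ?size_map ?size_iota /=; nia.
have dist i j : i < j < n -> i = j %[mod t] -> u i != u j.
  move=> /andP[ij jn] ijt; have := hu j jn; rewrite mem_cat => /norP[+ _].
  by apply: contraNneq => <-; apply/row_prefixP => //; exists i.
exists u; split=> // i ltin.
have [l wl li] := modn_window (n - t) i t0.
have [nl ln] : n - t <= l /\ l < n by lia.
rewrite -(rowsum_mod _ _ li) rowsum_last //; last lia.
have := hu l ln; rewrite mem_cat ifF; last lia.
case/norP => _ lS.
(* At the last index [l] of the row the claim says that the sum of the entries before [l] is
   nonzero; this was arranged when [u (l - t)] was chosen. *)
have [{li wl}->|il] := eqVneq i l.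
  rewrite -subr_eq0 opprD addrA addrAC subrr add0r oppr_eq0.
  rewrite (@rowsum_mod _ _ _ _ (l - t)); last by rewrite -[in LHS](@subnK t l) ?modnDr //; lia.
  rewrite rowsum_last; [|lia|lia].
  have := hu (l - t); rewrite mem_cat ifT; last lia.
  rewrite addr_eq0 oppr_pchar2 // eq_sym mem_seq1 => /(_ _)/norP[]//; lia.
have il' : i < l.
  by rewrite ltn_neqAle il (@eqmod_le t) //; lia.
(* Equality would make [u l] the running sum plus [u i], a forbidden value. *)
apply: contraNneq lS => E; apply/mapP; exists (u i).
  by apply/row_prefixP => //; exists i.
by rewrite E addKr_pchar2.
Qed.

(** * The full bound *)

Lemma row_avoid (F : finFieldType) n t (H : n.-tuple F -> F) u d p :
  2 \in [pchar F]%R -> 1 < t -> 0 < n -> corrects_burst t (W_family t H) ->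
  (forall i, i < n -> u i != rowsum t n i u) ->
  (forall i, i + t < n -> u i != u (i + t)) ->
  d <= n -> p <= n -> p = n %[mod t] ->
  H (word n (ins n t d u)) != ins n t d u p.
Proof.
move=> ch2 t1 n0 hc us ut dn pn pt; have t0 := ltnW t1.
have step i : i < n -> ins n t d u i != ins n t d u (i + t).
  move=> ltin; apply: ins_neq => //; first exact: us.
    by move=> itd; apply: ut; lia.
  by move=> dti; have := ut (i - t); rewrite subnK; [apply|lia].
have w0 := ins_zero_rows u ch2 t0 dn.
have [ltpn|np] := ltnP p n.
  by apply: (check_avoid ch2 hc w0 ltpn _ pt (step p ltpn)); lia.
(* The burst at n would return x itself; the one at n.-1 still removes position
   n because t > 1. *)
have n1 : n.-1 < n by lia.
by apply: (check_avoid ch2 hc w0 n1 _ pt (step n.-1 n1)); lia.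
Qed.

Lemma row_prefix_uniq (T : eqType) t (u : nat -> T) n : 0 < t ->
  (forall i j, i < j < n -> i = j %[mod t] -> u i != u j) ->
  uniq (row_prefix t u n).
Proof.
move=> t0 dist; have nt := leq_divM n t.
have step b c : c < b < n %/ t -> u (n - t * b.+1) != u (n - t * c.+1).
  move=> cb; apply: dist; first by nia.
  apply/esym/eqP; rewrite eqn_mod_dvd; last by nia.
  by apply/dvdnP; exists (b - c); nia.
rewrite map_inj_in_uniq ?iota_uniq // => b c; rewrite !mem_iota => bn cn E.
case: (ltngtP b c) => // bc.
  by have := step c b; rewrite E eqxx => /(_ _)/negP[]//; lia.
by have := step b c; rewrite E eqxx => /(_ _)/negP[]//; lia.
Qed.

Theorem theorem8p4 (t n m : nat) (F : finFieldType)
    (ht : 2 <= t) (hn : 2 * t <= n) (hm : 1 <= m) (hF : #|F| = 2 ^ m)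
    (H : n.-tuple F -> F)
    (hcorr : corrects_burst t (W_family t H)) :
  n + n %/ t + 2 <= #|F|.
Proof.
have ch2 : 2 \in [pchar F]%R := card_finPcharP hF isT.
have t0 := ltnW ht.
have [u [us dist]] :=
  exists_spread ch2 ht hn (field_lower_bound ch2 ht hn hcorr).
(* For every [d <= n], these are the symbols of [ins n t d u] in the row of [n] at positions up to
   [n]. *)
pose V := rowsum t n n u :: row_prefix t u n.
have -> : n + n %/ t + 2 = n.+1 - 0 + size V.
  by rewrite /= size_map size_iota; lia.
apply: (ins_counting (u := u) ch2 t0 hcorr).
- by move=> d /us.
- rewrite /= row_prefix_uniq // andbT; apply/negP => /row_prefixP[//|i [ltin it E]].
  by have := us i ltin; rewrite (rowsum_mod _ _ it) E eqxx.
move=> d dn; apply/negP => HV.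
have [p [pn pt pE]] : exists p,
    [/\ p <= n, p = n %[mod t] & ins n t d u p = H (word n (ins n t d u))].
  move: HV; rewrite inE => /predU1P[->|/row_prefixP[//|i [ltin it ->]]].
    have [p pd pt] := modn_window d n t0.
    exists p; rewrite ins_window // (rowsum_mod _ _ pt); split=> //.
    by apply: (eqmod_le pt); lia.
  (* An old entry stays or moves by [t]; being in the row of [n], it cannot pass [n]. *)
  exists (if i < d then i else i + t); split; last exact: del_ins.
    by case: ifP => _; [lia | apply: (@eqmod_le t); rewrite ?modnDr //; lia].
  by case: ifP; rewrite ?modnDr.
have := row_avoid ch2 ht _ hcorr us _ dn pn pt; rewrite pE eqxx.
case/(_ _ _)/negP => //; first by lia.
by move=> i itn; apply: dist; rewrite ?modnDr //; lia.
Qed.
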